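(* Let $d\ge 1$ and let $S=(\bm{x}_i,z_i)_{i=1,\dots,N}$ be a set of $N$ points in $\mathbb{R}^{d+1}$ ($\bm{x}_i\in\mathbb{R}^d$, $z_i\in\mathbb{R}$), with $N\ge d+1$ and with $(\bm{x}_i)_{i=1,\dots,N}$ in general position in $\mathbb{R}^d$. Then any continuous piecewise linear (CPWL) interpolation of $S$ has a well-behaved version with respect to $S$.
   Context: General position: any subset of $d+1$ of the points $\bm{x}_i$ is affinely independent. Let $S_{\mathbb{R}^d}=\{\bm{x}_1,\dots,\bm{x}_N\}$ and let $D$ be the convex hull of $S_{\mathbb{R}^d}$. CPWL function: $f:D\to\mathbb{R}$ is CPWL when $f$ is continuous and there is a finite set of affine functions $\{f_k:D_k\to\mathbb{R},\ k=1,\dots,P\}$ such that the $D_k$ are compact, $\bigcup_{k=1}^P D_k=D$ and $f_{|D_k}=f_k$ for all $k$. The $f_k$ are the affine pieces of $f$ and the $D_k$ its affine domains. The $D_k$ need not form a partition of $D$: the intersection of two affine domains may have non-empty interior, an affine domain can be empty, and two affine domains can be equal as long as the corresponding affine pieces are equal. The family of affine pieces representing $f$ is not unique; a CPWL function is considered together with a chosen family of affine pieces. Interpolation: $f:D\to\mathbb{R}$ interpolates $S$ when $f(\bm{x}_i)=z_i$ for all $i$. An affine piece $f_k:D_k\to\mathbb{R}$ interpolates the point $(\bm{x}_i,z_i)$ of $S$ when $\bm{x}_i\in D_k$ and $f_k(\bm{x}_i)=z_i$. Well-behaved: a CPWL interpolation $f$ of $S$ is well-behaved when each affine piece of $f$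 interpolates at least $d+1$ points of $S$. Well-behaved version: let $f$ and $g$ be two CPWL interpolations of $S$ composed of the sets of affine pieces $\{f_k:D_k\to\mathbb{R},\ k=1,\dots,P\}$ and $\{g_k:D'_k\to\mathbb{R},\ k=1,\dots,P\}$ (same number $P$). Then $g$ is a well-behaved version of $f$ with respect to $S$ if $g$ is a well-behaved CPWL interpolation of $S$ and $D_k\cap S_{\mathbb{R}^d}\subseteq D'_k\cap S_{\mathbb{R}^d}$ for all $k\in\{1,\dots,P\}$. *)

(* Defs.v *)
From HB Require Import structures.
From mathcomp Require Import all_boot all_order all_algebra.
From mathcomp Require Import all_classical all_reals all_analysis.

Set Implicit Arguments.
Unset Strict Implicit.
Unset Printing Implicit Defensive.

Import Order.TTheory GRing.Theory Num.Theory.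
Import numFieldNormedType.Exports.

Local Open Scope classical_set_scope.
Local Open Scope ring_scope.

Definition affinely_independent (R : realType) (d N : nat)
    (x : 'I_N -> 'rV[R]_d) (A : {set 'I_N}) : Prop :=
  forall c : 'I_N -> R,
    \sum_(i in A) c i = 0 -> \sum_(i in A) c i *: x i = 0 ->
    forall i, i \in A -> c i = 0.

(* Subsets are taken over indices, so for 1 <= d and d + 1 <= N general position
   forces the points to be pairwise distinct. *)
Definition general_position (R : realType) (d N : nat)
    (x : 'I_N -> 'rV[R]_d) : Prop :=
  forall A : {set 'I_N}, #|A| = d.+1 -> affinely_independent x A.

Definition convex_hull (R : realType) (d : nat) (A : set 'rV[R]_d) :
    set 'rV[R]_d :=
  smallest (@convex_set R 'rV[R]_d) A.

Definition affine_on (R : realType) (d : nat) (A : set 'rV[R]_d)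
    (h : 'rV[R]_d -> R) : Prop :=
  exists (a : {scalar 'rV[R]_d}) (b : R), forall y, A y -> h y = a y + b.

(* A CPWL function on D bundled with a chosen family of P affine pieces.
   [cpwl_fun] and [piece k] are total functions of which only the values on D,
   respectively on [dom k], are meaningful; in particular g and h are the same
   piece with domain A as soon as they agree on A.  No disjointness,
   non-emptiness or injectivity of the family of domains is imposed. *)
Record cpwl (R : realType) (d : nat) (D : set 'rV[R]_d) (P : nat) := CPWL {
  cpwl_fun :> 'rV[R]_d -> R ;
  piece : 'I_P -> 'rV[R]_d -> R ;
  dom : 'I_P -> set 'rV[R]_d ;
  cpwl_continuous : {within D, continuous cpwl_fun} ;
  piece_affine : forall k, affine_on (dom k) (piece k) ;
  dom_compact : forall k, compact (dom k) ;
  dom_cover : \bigcup_k dom k = D ;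
  cpwl_piece : forall k y, dom k y -> cpwl_fun y = piece k y
}.

Definition interpolates (R : realType) (d N : nat) (x : 'I_N -> 'rV[R]_d)
    (z : 'I_N -> R) (f : 'rV[R]_d -> R) : Prop :=
  forall i, f (x i) = z i.

Definition piece_interpolates (R : realType) (d N : nat)
    (x : 'I_N -> 'rV[R]_d) (z : 'I_N -> R) (D : set 'rV[R]_d) (P : nat)
    (f : cpwl D P) (k : 'I_P) (i : 'I_N) : Prop :=
  dom f k (x i) /\ piece f k (x i) = z i.

Definition well_behaved (R : realType) (d N : nat) (x : 'I_N -> 'rV[R]_d)
    (z : 'I_N -> R) (D : set 'rV[R]_d) (P : nat) (f : cpwl D P) : Prop :=
  forall k, (d.+1 <= #|[pred i | `[< piece_interpolates x z f k i >]]|)%N.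

Definition well_behaved_version (R : realType) (d N : nat)
    (x : 'I_N -> 'rV[R]_d) (z : 'I_N -> R) (D : set 'rV[R]_d) (P : nat)
    (f g : cpwl D P) : Prop :=
  [/\ interpolates x z f, interpolates x z g, well_behaved x z g
    & forall k, dom f k `&` range x `<=` dom g k `&` range x].

(* Main.v *)
(* Each affine piece u_k of f is replaced by an affine function v_k with at least
   d + 1 zeros of v_k(x_i) - z_i, such that v_k(x_i) - z_i is for every i a
   nonnegative multiple of u_k(x_i) - z_i: as in the simplex method, one walks to
   a vertex of the polyhedron cut out by these sign conditions, which contains no
   line because the x_i affinely span R^d.  On the convex set D, f is the max-min
   polynomial max_b min {u_k : f b <= u_k b}, and g is the same polynomial in the
   v_k.  Its value at x_i is still z_i, because comparing a max-min polynomial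
   with z_i only involves the signs of its arguments minus z_i. *)
From HB Require Import structures.
Require Import Defs.
From mathcomp Require Import all_boot all_order all_algebra.
From mathcomp Require Import all_classical all_reals all_analysis.
From mathcomp Require Import ring lra.

Set Implicit Arguments.
Unset Strict Implicit.
Unset Printing Implicit Defensive.

Import Order.TTheory GRing.Theory Num.Theory.
Import numFieldNormedType.Exports.

Local Open Scope classical_set_scope.
Local Open Scope ring_scope.

(** * Affine functions in homogeneous coordinates *)

(** The column [w] stacks the linear part over the constant term, so that vanishing at given points
    is a linear system in [w]. *)
Definition affine_fun (R : realType) (d : nat) (w : 'cV[R]_(d + 1))
    (y : 'rV[R]_d) : R := (row_mx y 1%:M *m w) 0 0.

Definition dot (R : realType) (d : nat) (c : 'cV[R]_d) (y : 'rV[R]_d) : R :=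
  (y *m c) 0 0.

Lemma dot_is_scalar (R : realType) (d : nat) (c : 'cV[R]_d) : scalar (dot c).
Proof. by move=> t u v; rewrite /dot mulmxDl -scalemxAl !mxE. Qed.

HB.instance Definition _ (R : realType) (d : nat) (c : 'cV[R]_d) :=
  GRing.isLinear.Build R 'rV[R]_d R _ (dot c) (dot_is_scalar c).

Section AffineFunctions.
Context (R : realType) (d : nat).
Implicit Types (w : 'cV[R]_(d + 1)) (y : 'rV[R]_d).

Lemma affine_funE w y : affine_fun w y = dot (usubmx w) y + dsubmx w 0 0.
Proof.
by rewrite /affine_fun /dot -{1}(vsubmxK w) mul_row_col mul1mx mxE.
Qed.

Lemma affine_fun_affine_on (A : set 'rV[R]_d) w : affine_on A (affine_fun w).
Proof. by exists (dot (usubmx w)), (dsubmx w 0 0) => y _; exact: affine_funE. Qed.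

Lemma affine_funDZ v (t : R) h y :
  affine_fun (v + t *: h) y = affine_fun v y + t * affine_fun h y.
Proof. by rewrite /affine_fun mulmxDr -scalemxAr !mxE. Qed.

Lemma affine_fun_segment w (a b : 'rV[R]_d) (t : R) :
  affine_fun w (a + t *: (b - a)) =
  affine_fun w a + t * (affine_fun w b - affine_fun w a).
Proof. by rewrite !affine_funE linearD linearZ linearB /=; ring. Qed.

Lemma affine_fun_surj (a : {scalar 'rV[R]_d}) (b : R) :
  exists w, forall y, a y + b = affine_fun w y.
Proof.
exists (col_mx (\col_j a (delta_mx 0 j)) b%:M) => y.
rewrite affine_funE col_mxKu col_mxKd [X in _ = _ + X]mxE eqxx mulr1n.
congr (_ + _); rewrite {1}[y]row_sum_delta linear_sum /dot mxE.
by apply: eq_bigr => j _; rewrite linearZ mxE.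
Qed.

Lemma continuous_affine_fun w : continuous (affine_fun w).
Proof.
rewrite (_ : affine_fun w = fun y =>
   \big[+%R/dsubmx w 0 0]_(j < d) (y 0 j * usubmx w j 0)); last first.
  apply/funext => y; rewrite affine_funE /dot mxE.
  by elim/big_rec2: _ => [|i u v _ <-]; rewrite ?add0r// addrA.
apply: continuous_big => [|j _ y]; first exact: add_continuous.
by apply: (@cvgMr_tmp R _ _ (nbhs_filter y)); exact: coord_continuous.
Qed.

End AffineFunctions.

(** * Finite minima and maxima of continuous functions *)

Lemma exists_continuous_min (R : realType) (T : topologicalType) (I : eqType)
    (F : I -> T -> R) (s : seq I) :
  (forall i, continuous (F i)) -> s != [::] ->
  exists h : T -> R, [/\ continuous h,
    forall y i, i \in s -> h y <= F i y &
    forall y, exists2 i, i \in s & h y = F i y].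
Proof.
move=> Fc; elim: s => // i s IH _; have [->|/IH[h [hc hle hatt]]] := eqVneq s [::].
  exists (F i); split=> // [y j|y]; first by rewrite inE => /eqP ->.
  by exists i => //; rewrite mem_head.
exists (F i \min h); split=> [y|y j|y].
- exact: (continuous_min (@Fc i y) (@hc y)).
- by rewrite inE /= ge_min => /orP[/eqP ->|/(hle y) ->]; rewrite ?lexx ?orbT.
- rewrite /=; case: (leP (F i y) (h y)) => _; first by exists i; rewrite ?mem_head.
  by have [j js ->] := hatt y; exists j; rewrite // inE js orbT.
Qed.

Lemma exists_continuous_max (R : realType) (T : topologicalType) (I : eqType)
    (F : I -> T -> R) (s : seq I) :
  (forall i, continuous (F i)) -> s != [::] ->
  exists h : T -> R, [/\ continuous h,
    forall y i, i \in s -> F i y <= h y &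
    forall y, exists2 i, i \in s & h y = F i y].
Proof.
move=> Fc /(@exists_continuous_min R T I (fun i y => - F i y))[i y|].
  exact: (@continuousN _ _ _ _ y (@Fc i y)).
move=> h [hc hle hatt]; exists (fun y => - h y); split=> [y|y i /(hle y)|y].
- exact: (@continuousN _ _ _ _ y (@hc y)).
- by rewrite lerNr.
- by have [i si ->] := hatt y; exists i; rewrite ?opprK.
Qed.

(** * Tight affine functions at points in general position *)

(** The homogeneous coordinates of the first [d + 1] points form a square matrix; affine
    independence makes its rows free, so it is invertible. *)
Lemma general_position_affine_fun_eq0 (R : realType) (d N : nat)
    (x : 'I_N -> 'rV[R]_d) (h : 'cV[R]_(d + 1)) :
  (d.+1 <= N)%N -> general_position x ->
  (forall i, affine_fun h (x i) = 0) -> h = 0.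
Proof.
move=> hN hx h0; pose e : 'I_d.+1 -> 'I_N := widen_ord hN.
have e_inj : injective e by move=> i j /(congr1 (@nat_of_ord N)) ij; exact: val_inj.
pose M := \matrix_(i < d.+1) row_mx (x (e i)) (1%:M : 'M[R]_1).
have Mfree : row_free M.
  apply: inj_row_free => v vM.
  have {}vM : row_mx (\sum_i v 0 i *: x (e i)) (\sum_i v 0 i *: 1%:M) = 0
      :> 'rV[R]_(d + 1).
    rewrite -[RHS]vM mulmx_sum_row -[RHS]hsubmxK !linear_sum /=.
    by congr row_mx; apply: eq_bigr => i _;
      rewrite linearZ /= rowK ?row_mxKl ?row_mxKr.
  move: vM; rewrite -row_mx0 => /eq_row_mx[vx /matrixP/(_ 0 0)].
  rewrite summxE !mxE => v1.
  (* [inord] sends indices beyond [d] to 0; those values of [c] are harmless, since only indices in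
     the image of [e] are summed. *)
  pose c (j : 'I_N) : R := v 0 (inord j).
  have ce i : c (e i) = v 0 i by rewrite /c /= inord_val.
  have := hx [set e i | i : 'I_d.+1]; rewrite card_imset// card_ord => /(_ erefl c).
  rewrite !(big_imset _ (in2W e_inj)) /=.
  have -> : \sum_(i in 'I_d.+1) c (e i) = 0.
    by rewrite -[RHS]v1; apply: eq_bigr => i _; rewrite ce !mxE mulr1.
  have -> : \sum_(i in 'I_d.+1) c (e i) *: x (e i) = 0.
    by rewrite -[RHS]vx; apply: eq_bigr => i _; rewrite ce.
  move=> /(_ erefl erefl) c0; apply/rowP => i.
  by rewrite mxE -ce c0// imset_f.
have Mfull : row_full M by apply: etrans Mfree; rewrite /row_full [X in _ == X]addn1.
apply: (row_full_inj Mfull); rewrite mulmx0; apply/row_matrixP => i.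
rewrite row_mul rowK row0; apply/rowP => j.
by rewrite ord1 [RHS]mxE; exact: (h0 (e i)).
Qed.

(** At most [d] homogeneous equations in [d + 1] unknowns have a nonzero solution, here a nonzero
    row of the kernel. *)
Lemma exists_affine_fun_vanishing (R : realType) (d N : nat)
    (x : 'I_N -> 'rV[R]_d) (Z : {set 'I_N}) : (#|Z| <= d)%N ->
  exists2 h : 'cV[R]_(d + 1), h != 0 & forall i, i \in Z -> affine_fun h (x i) = 0.
Proof.
move=> Zd.
pose M := \matrix_(i < #|Z|) row_mx (x (enum_val i)) (1%:M : 'M[R]_1).
have kM0 : kermx M^T != 0.
  rewrite kermx_eq0 /row_free mxrank_tr neq_ltn.
  by rewrite (leq_ltn_trans (rank_leq_row M))// addn1 ltnS.
exists (nz_row (kermx M^T))^T.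
  apply: contra kM0 => /eqP/(congr1 trmx).
  by rewrite trmxK trmx0 => /eqP; rewrite nz_row_eq0.
move=> i iZ; have /sub_kermxP/(congr1 trmx) := nz_row_sub (kermx M^T).
rewrite trmx_mul trmxK trmx0 => /row_matrixP/(_ (enum_rank_in iZ i)).
by rewrite row_mul rowK row0 enum_rankK_in// => /rowP/(_ 0); rewrite [RHS]mxE.
Qed.

(** Induction on the number of tight points. While at most [d] are tight, moving along a nonzero [h]
    that vanishes at them keeps them tight; [h] is nonzero at some [x j], so a new point can be
    reached. *)
Lemma exists_tight_affine_fun (R : realType) (d N : nat)
    (x : 'I_N -> 'rV[R]_d) (z : 'I_N -> R) (u : 'cV[R]_(d + 1)) :
  (forall h : 'cV[R]_(d + 1), (forall i, affine_fun h (x i) = 0) -> h = 0) ->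
  exists v : 'cV[R]_(d + 1),
    (forall i, exists2 l, 0 <= l &
       affine_fun v (x i) - z i = l * (affine_fun u (x i) - z i)) /\
    (d.+1 <= #|[set i | affine_fun v (x i) == z i]%SET|)%N.
Proof.
move=> x_inj; move: {1 3}d.+1 (leqnn d.+1) => m; elim: m=> [_|n IH nd].
  by exists u; split=> // i; exists 1; rewrite ?mul1r.
have [v [vu nZ]] := IH (ltnW nd).
set Z := [set i | _]%SET in nZ; have [Zn|nZ'] := leqP #|Z| n; last first.
  by exists v; split=> //; exact: nZ'.
have [h h0 hZ] := @exists_affine_fun_vanishing R d N x Z (leq_trans Zn nd).
have [j hj] : exists j, affine_fun h (x j) != 0.
  apply: contrapT => hN; move/eqP: h0; apply; apply: x_inj => i.
  by apply/eqP; apply: contrapT => /negP hi; apply: hN; exists i.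
pose r i := (z i - affine_fun v (x i)) / affine_fun h (x i).
(* Ratio test: the shortest move along [h] at which a new point becomes tight. *)
case: (@arg_minP _ _ _ j (fun i => affine_fun h (x i) != 0) (fun i => `|r i|) hj).
move=> k hk rk.
have kE : affine_fun (v + r k *: h) (x k) = z k.
  by rewrite affine_funDZ /r divfK// addrC subrK.
exists (v + r k *: h); split=> [i|].
- have [l l0 lE] := vu i; rewrite affine_funDZ.
  have [hi|hi] := eqVneq (affine_fun h (x i)) 0.
    by exists l; rewrite // hi mulr0 addr0.
  have [ri|ri] := eqVneq (r i) 0.
    have : r k = 0 by apply/eqP; rewrite -normr_le0 -(normr0 R) -ri rk.
    by move=> ->; exists l; rewrite // mul0r addr0.
  have rki : r k / r i <= 1.
    rewrite (le_trans (ler_norm _))// normrM normfV ler_pdivrMr ?normr_gt0//.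
    by rewrite mul1r rk.
  (* The residual at [x i] passes from [- r i * affine_fun h (x i)] to
     [(r k - r i) * affine_fun h (x i)]: it is scaled by [1 - r k / r i]. *)
  exists ((1 - r k / r i) * l); first by rewrite mulr_ge0// subr_ge0.
  rewrite -[RHS]mulrA -lE; have vz : z i - affine_fun v (x i) = r i * affine_fun h (x i).
    by rewrite /r divfK.
  have -> : affine_fun v (x i) = z i - r i * affine_fun h (x i) by rewrite -vz; ring.
  by field.
- apply: leq_ltn_trans nZ _; apply: proper_card; apply/properP; split.
    apply/fintype.subsetP => i iZ; move: (iZ).
    by rewrite !inE affine_funDZ hZ// mulr0 addr0.
  exists k; rewrite !inE ?kE//; apply: contra hk => vk.
  by rewrite hZ// inE.
Qed.

(** * Affine pieces along a segment *)

(** By contradiction, let [s] be the last time at which some line starting at or below [phi 0] is at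
    or above [phi]. Just after [s], [phi] meets a line that starts above [phi 0]; at [s] that line
    is strictly above [phi], against continuity. *)
Lemma exists_piece_across_unit_interval (R : realType) (I : finType)
    (phi : R -> R) (p q : I -> R) :
  continuous phi ->
  (forall t, 0 <= t <= 1 -> exists k, phi t = p k + t * q k) ->
  exists k, p k <= phi 0 /\ phi 1 <= p k + q k.
Proof.
move=> phic cover; apply: contrapT => nex.
have hi k : p k <= phi 0 -> p k + q k < phi 1.
  by move=> pk; rewrite ltNge; apply/negP => qk; apply: nex; exists k.
pose T := [set t : R | 0 <= t <= 1 /\ exists2 k, p k <= phi 0 & phi t <= p k + t * q k].
have T0 : T 0.
  split; first by rewrite lexx ler01.
  have [|k phik] := cover 0; first by rewrite lexx ler01.
  by exists k; rewrite phik mul0r addr0.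
have Tsup : has_sup T.
  by split; [exists 0 | exists 1 => t [/andP[]]].
pose s := sup T.
have s0 : 0 <= s by exact: sup_upper_bound.
have s1 : s <= 1 by apply: ge_sup; [exists 0 | move=> t [/andP[]]].
have sep k : \forall t \near s,
    (p k + s * q k < phi s -> p k + t * q k < phi t) /\
    (phi s < p k + s * q k -> phi t < p k + t * q k).
  have dc : (fun t => phi t - (p k + t * q k)) t @[t --> s] --> phi s - (p k + s * q k).
    apply: cvgB; first exact: phic.
    by apply: cvgD; [exact: cvg_cst | apply: cvgMr_tmp; exact: cvg_id].
  have [lt|gt|eq] := ltgtP (p k + s * q k) (phi s).
  - have d0 : 0 < phi s - (p k + s * q k) by rewrite subr_gt0.
    near=> t; split=> // _; rewrite -subr_gt0; near: t.
    exact: (cvgr_gt _ dc).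
  - have d0 : phi s - (p k + s * q k) < 0 by rewrite subr_lt0.
    near=> t; split=> // _; rewrite -subr_lt0; near: t.
    exact: (cvgr_lt _ dc).
  - by near=> t; split.
have [e /= e0 sepe] := (nbhs_ballP _ _).1 (filter_forall _ sep).
(* The supremum is attained: the finitely many lines share the radius [e], and a line strictly below
   [phi] at [s] stays so within [e] of [s]. *)
have [l pl sl] : exists2 l, p l <= phi 0 & phi s <= p l + s * q l.
  have [t [t01 [l pl tl]] ts] := sup_adherent e0 Tsup.
  exists l => //; rewrite leNgt; apply/negP => sl.
  have tle : t <= s by apply: sup_upper_bound => //; split=> //; exists l.
  have /sepe/(_ l)[/(_ sl)] : ball s e t.
    by rewrite /ball /= ger0_norm ?subr_ge0// ltrBlDr -ltrBlDl.
  by rewrite ltNge tl.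
have {}s1 : s < 1.
  rewrite lt_neqAle s1 andbT; apply/eqP => s1'.
  by have := hi _ pl; rewrite ltNge; move: sl; rewrite s1' mul1r => ->.
pose t := s + Num.min (1 - s) e / 2.
have m0 : 0 < Num.min (1 - s) e by rewrite lt_min subr_gt0 s1.
have st : s < t by rewrite /t; lra.
have te : t < s + e.
  by have : Num.min (1 - s) e <= e; [rewrite ge_min lexx orbT | rewrite /t; lra].
have t1 : t <= 1.
  by have : Num.min (1 - s) e <= 1 - s; [rewrite ge_min lexx | rewrite /t; lra].
have t01 : 0 <= t <= 1 by rewrite t1 andbT; lra.
have nTt : ~ T t by move=> /(sup_upper_bound Tsup); rewrite -/s leNgt st.
have [k phik] := cover t t01.
have pk : phi 0 < p k.
  by rewrite ltNge; apply/negP => pk; apply: nTt; split=> //; exists k; rewrite // phik.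
have tl : p l + t * q l < phi t.
  by rewrite ltNge; apply/negP => tl; apply: nTt; split=> //; exists l.
have /sepe/(_ k)[_] : ball s e t by rewrite /ball /= ltr0_norm ?subr_lt0//; lra.
rewrite -phik ltxx => noncross; suff: false by []; apply: noncross.
apply: (le_lt_trans sl).
have t0 : 0 < t by lra.
(* The gap between lines [k] and [l] is positive at 0 and at [t]; multiplied by [t], the gap at [s]
   combines these two with weights [t - s] and [s]. *)
rewrite -(ltr_pM2l t0) -subr_gt0.
have -> : t * (p k + s * q k) - t * (p l + s * q l) =
    (t - s) * (p k - p l) + s * (phi t - (p l + t * q l)) by rewrite phik; ring.
by rewrite ltr_wpDr ?mulr_ge0 ?mulr_gt0//; lra.
Unshelve. all: by end_near.
Qed.

Lemma sub_convex_hull (R : realType) (d : nat) (A : set 'rV[R]_d) :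
  A `<=` convex_hull A.
Proof. exact: sub_smallest. Qed.

Lemma convex_hull_segment (R : realType) (d : nat) (A : set 'rV[R]_d)
    (a b : 'rV[R]_d) (t : R) :
  convex_hull A a -> convex_hull A b -> 0 <= t <= 1 ->
  convex_hull A (a + t *: (b - a)).
Proof.
move=> Da Db /andP[t0 t1] X [cX AX].
have /set_mem := cX b a (Itv01 t0 t1)
  (mem_set (Db X (conj cX AX))) (mem_set (Da X (conj cX AX))).
congr (X _); rewrite /conv /= /unstable.onem scalerBl scale1r scalerBr.
by rewrite [LHS]addrCA.
Qed.

(* This is what makes [f] equal to the max-min of its pieces (Ovchinnikov). *)
Lemma exists_piece_across_segment (R : realType) (d : nat) (D : set 'rV[R]_d)
    (I : finType) (f : 'rV[R]_d -> R) (w : I -> 'cV[R]_(d + 1)) (a b : 'rV[R]_d) :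
  (forall t, 0 <= t <= 1 -> D (a + t *: (b - a))) ->
  {within D, continuous f} ->
  (forall y, D y -> exists k, f y = affine_fun (w k) y) ->
  exists k, affine_fun (w k) a <= f a /\ f b <= affine_fun (w k) b.
Proof.
move=> segD /subspace_continuousP fc cover.
(* Continuity of [f] holds only within [D]; clamping the parameter to the unit interval keeps the
   path in [D], so the composite is continuous on all of [R]. *)
pose clamp (t : R) := Num.max 0 (Num.min t 1).
have clamp01 t : 0 <= clamp t <= 1.
  by rewrite /clamp le_max lexx /= ge_max ler01 ge_min lexx orbT.
have clampE t : 0 <= t <= 1 -> clamp t = t.
  by move=> /andP[t0 t1]; rewrite /clamp min_l// max_r.
pose gam t := a + clamp t *: (b - a).
have gamc : continuous gam.
  move=> t; apply: cvgD; first exact: cvg_cst.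
  apply: (@cvgZr_tmp R 'rV[R]_d R (nbhs t)).
  have idc : {for t, continuous (idfun : R -> R^o)} by exact: cvg_id.
  have cstc c : {for t, continuous (cst c : R -> R^o)} by exact: cvg_cst.
  exact: (continuous_max (cstc 0) (continuous_min idc (cstc 1))).
have phic : continuous (f \o gam).
  move=> t Q /(fc _ (segD _ (clamp01 t))) DQ.
  have : \forall s \near t, D (gam s) -> Q (f (gam s)).
    exact: (gamc t (fun y => D y -> Q (f y)) DQ).
  by apply: filterS => s; apply; exact: (segD _ (clamp01 s)).
have [t t01|k] := @exists_piece_across_unit_interval R I (f \o gam)
    (fun k => affine_fun (w k) a)
    (fun k => affine_fun (w k) b - affine_fun (w k) a) phic.
  have [k fk] := cover _ (segD _ t01); exists k.
  by rewrite /= /gam clampE// fk affine_fun_segment.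
rewrite /= /gam !clampE ?lexx ?ler01// scale0r addr0 scale1r !subrKC => kP.
by exists k.
Qed.

(** * Construction of the well-behaved version *)

Lemma cpwl_domain_compact (R : realType) (d P : nat) (D : set 'rV[R]_d)
    (f : cpwl D P) : compact D.
Proof.
rewrite -(dom_cover f) (_ : setT = [set` enum 'I_P]); last first.
  by apply/seteqP; split=> k //= _; rewrite mem_enum.
by rewrite bigcup_seq; apply: bigsetU_compact => k _; exact: dom_compact.
Qed.

Theorem theorem1 (R : realType) (d N : nat)
    (x : 'I_N -> 'rV[R]_d) (z : 'I_N -> R)
    (hd : (1 <= d)%N) (hN : (d.+1 <= N)%N) (hx : general_position x)
    (P : nat) (f : cpwl (convex_hull (range x)) P) (hf : interpolates x z f) :
  exists g : cpwl (convex_hull (range x)) P, well_behaved_version x z f g.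
Proof.
set D := convex_hull (range x).
have xD i : D (x i) by apply: sub_convex_hull; exists i.
have /choice[u uE] : forall k : 'I_P, exists w : 'cV[R]_(d + 1),
    forall y, dom f k y -> f y = affine_fun w y.
  move=> k; have [a [b abE]] := piece_affine f k.
  have [w wE] := affine_fun_surj a b.
  by exists w => y ky; rewrite -wE -abE//; exact: cpwl_piece.
have cover y : D y -> exists k, f y = affine_fun (u k) y.
  move=> Dy; have [k _ ky] : (\bigcup_k dom f k) y by rewrite dom_cover.
  by exists k; exact: uE.
have [v vP] := choice (fun k => exists_tight_affine_fun z (u k)
  (fun h => general_position_affine_fun_eq0 hN hx)).
have vle k i : affine_fun (u k) (x i) <= z i -> affine_fun (v k) (x i) <= z i.
  move=> uz; have [/(_ i)[l l0 lE] _] := vP k.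
  by rewrite -subr_le0 lE mulr_ge0_le0// subr_le0.
have vge k i : z i <= affine_fun (u k) (x i) -> z i <= affine_fun (v k) (x i).
  move=> uz; have [/(_ i)[l l0 lE] _] := vP k.
  by rewrite -subr_ge0 lE mulr_ge0// subr_ge0.
(* [f] is the maximum over [b] in [D] of the minimum of the [u k] with [k] in
   [M b]; the same max-min formula applied to the [v k] defines [g]. *)
pose M b := [set k | f b <= affine_fun (u k) b]%SET.
(* [M b] takes finitely many values, so the maximum over [D] is one over the list [S]. *)
pose S := [seq A <- enum {set 'I_P} | `[< exists2 b, D b & A = M b >]].
have MS b : D b -> M b \in S.
  by move=> Db; rewrite mem_filter mem_enum andbT; apply/asboolP; exists b.
have SM A : A \in S -> exists2 b, D b & A = M b.
  by rewrite mem_filter => /andP[/asboolP].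
(* Outside [S], the dummy [cst 0] keeps every [m A] defined and continuous. *)
have /choice[m mP] : forall A : {set 'I_P}, exists h : 'rV[R]_d -> R,
    [/\ continuous h,
        A \in S -> forall y k, k \in A -> h y <= affine_fun (v k) y &
        A \in S -> forall y, exists2 k, k \in A & h y = affine_fun (v k) y].
  move=> A; have [AS|AS] := boolP (A \in S); last first.
    by exists (cst 0); split=> //; exact: cst_continuous.
  have A0 : enum A != [::].
    have [b Db AE] := SM A AS; have [k fk] := cover b Db.
    have : k \in enum A by rewrite mem_enum AE inE fk.
    by case: (enum A).
  have [h [hc hle hatt]] :=
    exists_continuous_min (fun k => @continuous_affine_fun R d (v k)) A0.
  exists h; split=> // _ y; first by move=> k kA; apply: hle; rewrite mem_enum.
  by have [k] := hatt y; rewrite mem_enum; exists k.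
pose i0 := Ordinal (leq_ltn_trans (leq0n d) hN).
have S0 : S != [::].
  by have := MS _ (xD i0); case: S {MS SM mP} => [|? ?]; rewrite ?in_nil.
have mc A : continuous (m A) by case: (mP A).
have [g [gc gge gatt]] := exists_continuous_max mc S0.
have gv y : exists k, g y = affine_fun (v k) y.
  have [A AS ->] := gatt y; have [_ _ /(_ AS y)[k _ ->]] := mP A.
  by exists k.
have gx i : g (x i) = z i.
  apply/eqP; rewrite eq_le; apply/andP; split.
  (* Crossing from [x i] to [b] shows that [M b] contains some [k] with [u k] at most [z i] at
     [x i]; [v k] inherits this. *)
  - have [A AS ->] := gatt (x i); have [_ mle _] := mP A.
    have [b Db AE] := SM A AS.
    have [k [kx kb]] := exists_piece_across_segment
      (fun t => convex_hull_segment (xD i) Db) (@cpwl_continuous _ _ _ _ f) cover.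
    rewrite hf in kx; apply: le_trans (mle AS _ k _) (vle _ _ kx).
    by rewrite AE inE.
  (* For [b = x i], all [k] in [M b] have [u k], hence [v k], at least [z i] at [x i]. *)
  - apply: le_trans (gge _ _ (MS _ (xD i))).
    have [_ _ /(_ (MS _ (xD i)) (x i))[k]] := mP (M (x i)).
    by rewrite inE hf => kx ->; exact: vge.
(* The full coincidence set in [D] is the largest possible domain; it contains all tight points of
   [v k]. *)
pose domg k := D `&` [set y | g y = affine_fun (v k) y].
have domg_compact k : compact (domg k).
  apply: compact_closedI; first exact: cpwl_domain_compact f.
  rewrite (_ : [set _ | _] = (fun y => g y - affine_fun (v k) y) @^-1` [set 0]).
    apply: closed_comp; last exact: closed_eq.
    by move=> y _; exact: (cvgB (@gc y) (@continuous_affine_fun R d (v k) y)).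
  by apply/seteqP; split=> y /= => [->|/eqP]; rewrite ?subrr// subr_eq0 => /eqP.
have domg_cover : \bigcup_k domg k = D.
  apply/seteqP; split=> [y [k _ []]//|y Dy].
  by have [k gk] := gv y; exists k.
have domgE k y : domg k y -> g y = affine_fun (v k) y by case.
exists (CPWL (continuous_subspaceT gc) (fun k => affine_fun_affine_on (domg k) (v k))
  domg_compact domg_cover domgE); split=> // k.
- have [_ vZ] := vP k; apply: leq_trans vZ _; apply: subset_leq_card.
  apply/fintype.subsetP => i; rewrite inE => /eqP vi.
  rewrite unfold_in /=; apply/asboolP.
  by split=> //=; split=> //=; rewrite gx vi.
(* If [x i] lies in [dom f k], then [u k] equals [z i] there, so both sign comparisons apply and
   force [v k] to equal [z i]. *)
- move=> y [+ [i _ ix]]; rewrite -{y}ix => kx; split; last by exists i.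
  split=> //=; rewrite gx; apply/eqP; rewrite eq_le.
  by rewrite vge ?vle// -(uE _ _ kx) hf.
Qed.
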